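(* Let $L$ be a dcpo. Then the following conditions are equivalent: (1) $L$ is hypercontinuous; (2) $L$ is strongly continuous and $\ll_s\,=\,\prec$ (as relations on $L$); (3) $L$ is strongly continuous and $\upsilon(L)=\sigma_s(L)$.
   Context: A dcpo is a poset in which every directed subset (directed sets are nonempty) has a supremum. For $x\in L$ and $A\subseteq L$: $\uparrow x=\{y\in L: x\le y\}$, $\downarrow x=\{y\in L: y\le x\}$, $\uparrow A=\bigcup_{a\in A}\uparrow a$; an upper set is a set $U$ with $U=\uparrow U$. The upper topology $\upsilon(L)$ is the topology generated by the subbase $\{L\}\cup\{L\setminus\downarrow x: x\in L\}$. Write $x\prec y$ iff $y\in\mathrm{int}_{\upsilon(L)}\uparrow x$. $L$ is hypercontinuous if for every $x\in L$ the set $\{y\in L: y\prec x\}$ is directed and has supremum $x$. Strong Scott topology: a subset $U\subseteq L$ is strongly Scott open if $U$ is an upper set and for every directed $D\subseteq L$ and every $x\in L$, $\bigcap_{d\in D}\uparrow d\cap\uparrow x\subseteq U$ implies $\uparrow d\cap\uparrow x\subseteq U$ for some $d\in D$. Let $\sigma^s(L)$ be the set of all strongly Scott open subsets. It is closed under binary intersections, and the strong Scott topology $\sigma_s(L)$ is the topology having $\sigma^s(L)$ as a base. A dcpo $L$ is strongly continuous (a strongly continuous domain) if for every $U\in\sigma_s(L)$ and $x\in U$ there is $u\in U$ with $x\in\mathrm{int}_{\sigma_s(L)}\uparrow u\subseteq\uparrow u\subseteq U$ (i.e. $(L,\sigma_s(L))$ is a C-space). Strong way-below relation: $x\ll_s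 y$ iff for every directed $D\subseteq L$ and every $a\in L$, $\bigcap_{d\in D}\uparrow d\cap\uparrow a\subseteq\uparrow y$ implies $\uparrow d\cap\uparrow a\subseteq\uparrow x$ for some $d\in D$. *)

(* Defs.v *)
From HB Require Import structures.
From mathcomp Require Import all_boot all_order all_classical.
From mathcomp Require Import topology.

Set Implicit Arguments.
Unset Strict Implicit.
Unset Printing Implicit Defensive.

Import Order.Theory.

Local Open Scope classical_set_scope.
Local Open Scope order_scope.

Section Poset.
Context {d : Order.disp_t} {L : porderType d}.
Implicit Types (x y a : L) (A D U : set L).

Definition up x : set L := [set y | x <= y].

Definition down x : set L := [set y | y <= x].

Definition up_closure A : set L := \bigcup_(a in A) up a.

Definition upper_set U : Prop := U = up_closure U.

Definition directed D : Prop :=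
  D !=set0 /\
  forall x y, D x -> D y -> exists z, [/\ D z, x <= z & y <= z].

Definition strongly_scott_open U : Prop :=
  upper_set U /\
  forall D x, directed D -> (\bigcap_(e in D) up e) `&` up x `<=` U ->
    exists2 e, D e & up e `&` up x `<=` U.

Definition strong_way_below x y : Prop :=
  forall D a, directed D -> (\bigcap_(e in D) up e) `&` up a `<=` up y ->
    exists2 e, D e & up e `&` up a `<=` up x.

Definition upper_subbase : set (set L) :=
  [set setT] `|` [set ~` down x | x in setT].

Lemma strongly_scott_openT : strongly_scott_open setT.
Proof.
split; last by move=> D x [[e De] _] _; exists e.
by apply/seteqP; split=> // x _; exists x => //; exact: lexx.
Qed.

Lemma strongly_scott_openI U V : strongly_scott_open U ->
  strongly_scott_open V -> strongly_scott_open (U `&` V).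
Proof.
move=> [upU oU] [upV oV]; split.
  apply/seteqP; split=> [x UVx|x [y [Uy Vy] yx]].
    by exists x => //; exact: lexx.
  by split; [rewrite upU|rewrite upV]; exists y.
move=> D x dD; rewrite subsetI => -[/oU-/(_ dD)[e De eU] /oV-/(_ dD)[f Df fV]].
have [g [Dg eg fg]] := dD.2 _ _ De Df.
exists g => // y [gy xy]; split.
  by apply: eU; split => //; exact: le_trans gy.
by apply: fV; split => //; exact: le_trans gy.
Qed.

End Poset.

Arguments upper_subbase {d} L.

Definition dcpo {d : Order.disp_t} (L : porderType d) : Prop :=
  forall D : set L, directed D -> exists s, supremums D s.

(* L carries two topologies, hence two copies of its carrier. *)
Definition upper_space {d : Order.disp_t} (L : porderType d) : Type := L.

Definition strong_scott_space {d : Order.disp_t} (L : porderType d) : Type := L.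

Section Topologies.
Context {d : Order.disp_t} (L : porderType d).

HB.instance Definition _ := Choice.copy (upper_space L) L.
HB.instance Definition _ :=
  isSubBaseTopological.Build (upper_space L) (upper_subbase L) id.

Let strong_scott_cover :
  \bigcup_(U in @strongly_scott_open d L) U = setT.
Proof.
by apply/seteqP; split=> // x _; exists setT => //; exact: strongly_scott_openT.
Qed.

Let strong_scott_join (U V : set L) (x : L) :
  strongly_scott_open U -> strongly_scott_open V -> U x -> V x ->
  exists W, [/\ strongly_scott_open W, W x & W `<=` U `&` V].
Proof.
by move=> oU oV Ux Vx; exists (U `&` V); split=> //; exact: strongly_scott_openI.
Qed.

HB.instance Definition _ := Choice.copy (strong_scott_space L) L.
HB.instance Definition _ := @isBaseTopological.Build (strong_scott_space L)
  (set L) (@strongly_scott_open d L) id strong_scott_cover strong_scott_join.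

End Topologies.

Definition upper_topology {d : Order.disp_t} (L : porderType d) :
  set (set L) := @open (upper_space L).

Definition strong_scott_topology {d : Order.disp_t} (L : porderType d) :
  set (set L) := @open (strong_scott_space L).

Arguments upper_topology {d} L.
Arguments strong_scott_topology {d} L.

Definition prec {d : Order.disp_t} {L : porderType d} (x y : L) : Prop :=
  @interior (upper_space L) (up x) y.

Definition hypercontinuous {d : Order.disp_t} (L : porderType d) : Prop :=
  forall x : L, directed [set y | prec y x] /\ supremums [set y | prec y x] x.

Definition strongly_continuous {d : Order.disp_t} (L : porderType d) : Prop :=
  forall (U : set L) (x : L), strong_scott_topology L U -> U x ->
    exists u : L, [/\ U u, @interior (strong_scott_space L) (up u) x
                     & up u `<=` U].

(* Main.v *)
From mathcomp Require Import all_boot all_order all_classical.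
From mathcomp Require Import finmap topology.
Require Import Defs.

(** Two comparisons carry the proof.

    First, the upper topology is contained in the strong Scott topology, whose
    open sets are in turn Scott open: they meet every directed set whose
    supremum they contain ([upper_topologyS], [strong_scott_topology_meets]).

    Second, as soon as y has a neighbourhood inside [up x] in either topology,
    it has one that is strongly Scott open, and this alone forces x to be
    strongly way below y ([strong_way_below_of_open]); conversely, strongly
    way below implies way below in the ordinary sense
    ([strong_way_below_le]).

    If L is hypercontinuous, x is the directed supremum of the elements prec x,
    so every strong Scott open set containing x contains some y with
    [prec y x]: the two topologies agree and form a C-space. Moreover, an
    element strongly way below x is below some y with [prec y x], hence is itself in
    relation prec with x. If prec agrees with
    strongly way below, the elements u witnessing strong continuity at x satisfy
    [prec u x], hence strong Scott open sets are upper open. Finally, if the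
    topologies agree, strong continuity is the C-space property of the upper
    topology, from which hypercontinuity follows
    ([strongly_continuous_hypercontinuous]). *)

Set Implicit Arguments.
Unset Strict Implicit.
Unset Printing Implicit Defensive.

Import Order.Theory.

Local Open Scope classical_set_scope.
Local Open Scope order_scope.

Section StrongScott.
Context {d : Order.disp_t} {L : porderType d}.
Implicit Types (x y z s u : L) (A B D U V : set L).

Lemma upper_set_le U x y : upper_set U -> U x -> x <= y -> U y.
Proof. by move=> upU Ux xy; rewrite upU; exists x. Qed.

(** If every [up e `&` up x], for e in D, met [down z], then z would be an
    upper bound of D above x, hence itself a point of [down z] in the
    intersection of the sets [up e] and [up x]. *)
Lemma strongly_scott_openC_down z : strongly_scott_open (~` down z).
Proof.
split.
  apply/seteqP; split=> [y yz|y [x xz xy]]; first by exists y => //; exact: lexx.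
  by move=> yz; apply: xz; exact: le_trans yz.
move=> D x [[e0 De0] _] DxU; apply: contrapT => noe.
have De e : D e -> e <= z /\ x <= z.
  move=> De; apply: contrapT => exz; apply: noe; exists e => // y [ey xy] yz.
  by apply: exz; split; [exact: le_trans ey yz|exact: le_trans xy yz].
apply: (DxU z); last exact: lexx.
by split=> [e /De[]//|]; have [] := De _ De0.
Qed.

Lemma strong_scott_topologyP U : strong_scott_topology L U <->
  forall x, U x -> exists V, [/\ strongly_scott_open V, V x & V `<=` U].
Proof.
split=> [[DD oDD <-] x [V DV Vx]|bU].
  by exists V; split=> //; [exact: oDD|exact: bigcup_sup].
exists [set V | strongly_scott_open V /\ V `<=` U]; first by move=> V [].
apply/seteqP; split=> [x [V [_ VU] /VU]//|x /bU[V [oV Vx VU]]].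
by exists V.
Qed.

Lemma upper_topologyC_down z : upper_topology L (~` down z).
Proof.
exists [set ~` down z]; last by rewrite bigcup_set1.
move=> _ ->; exists [fset (~` down z)]%fset; last first.
  by rewrite set_fset1 bigcap_set1.
by move=> A; rewrite inE => /eqP ->; apply/mem_set; right; exists z.
Qed.

Lemma strongly_scott_open_topology U :
  strongly_scott_open U -> strong_scott_topology L U.
Proof. by move=> oU; apply/strong_scott_topologyP => x Ux; exists U; split. Qed.

(** Upper open sets are unions of finite intersections of subbasic ones, and
    strongly Scott open sets are closed under finite intersections. *)
Lemma upper_topologyS : upper_topology L `<=` strong_scott_topology L.
Proof.
move=> U [DD fDD UE]; exists DD; last exact: UE.
move=> A /fDD[E sE <-]; rewrite bigcap_fset big_seq.
apply: (big_ind strongly_scott_open); [|exact: strongly_scott_openI|].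
  exact: strongly_scott_openT.
move=> B /sE/set_mem [->|[z _ <-]].
  exact: strongly_scott_openT.
exact: strongly_scott_openC_down.
Qed.

(** The condition defining both strongly Scott open sets (A = B) and the
    strongly way-below relation (A and B principal) implies its ordinary Scott
    counterpart: when a is taken in D, intersecting with [up a] is harmless,
    since a and the e that is found have a common upper bound in D. *)
Lemma supremum_meets D s A B : directed D -> supremums D s -> up s `<=` B ->
  (forall a, (\bigcap_(e in D) up e) `&` up a `<=` B ->
    exists2 e, D e & up e `&` up a `<=` A) ->
  exists2 e, D e & A e.
Proof.
move=> [[a Da] dD] [_ sD] sB /(_ a)[y [Dy _]|e De eA]; first exact/sB/sD.
have [f [Df ef af]] := dD _ _ De Da.
by exists f => //; exact: eA.
Qed.

Lemma strong_scott_topology_meets D s U : strong_scott_topology L U ->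
  directed D -> supremums D s -> U s -> exists2 e, D e & U e.
Proof.
move=> /strong_scott_topologyP oU dD Ds /oU[V [[upV sV] Vs VU]].
have [|a|e De Ve] := supremum_meets (A := V) (B := V) dD Ds.
- by move=> y; exact: upper_set_le.
- exact: sV.
- by exists e => //; exact: VU.
Qed.

Lemma strong_way_below_le D x y : strong_way_below x y ->
  directed D -> supremums D y -> exists2 e, D e & x <= e.
Proof.
move=> xy dD Dy; apply: (supremum_meets dD Dy (A := up x) (B := up y)) => // a.
exact: xy.
Qed.

(** If an intersection of up-sets lies in [up y], it lies in V, so the defining
    property of V applies to it. *)
Lemma strong_way_below_of_open V x y : strongly_scott_open V -> V y ->
  V `<=` up x -> strong_way_below x y.
Proof.
move=> [upV sV] Vy Vx D a dD Day; have [z /Day yz|e De eV] := sV D a dD.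
  exact: upper_set_le yz.
by exists e => // z /eV/Vx.
Qed.

Lemma precP x y :
  prec x y <-> exists V, [/\ upper_topology L V, V y & V `<=` up x].
Proof.
rewrite /prec /interior nbhsE; split=> [[V [oV Vy] Vx]|[V [oV Vy Vx]]].
  by exists V.
by exists V.
Qed.

Lemma strong_scott_interiorP A y : @interior (strong_scott_space L) A y <->
  exists V, [/\ strongly_scott_open V, V y & V `<=` A].
Proof.
rewrite /interior nbhsE; split=> [[V [/strong_scott_topologyP oV Vy] VA]|].
  by have [W [oW Wy WV]] := oV _ Vy; exists W; split=> // z /WV/VA.
move=> [V [oV Vy VA]]; exists V => //; split=> //.
exact: strongly_scott_open_topology.
Qed.

Lemma prec_le x y : prec x y -> x <= y.
Proof. exact: (@interior_subset (upper_space L)). Qed.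

Lemma le_prec_trans x y z : x <= y -> prec y z -> prec x z.
Proof.
move=> xy /precP[V [oV Vz Vy]]; apply/precP; exists V; split=> // w /Vy.
exact: le_trans.
Qed.

Lemma prec_strong_way_below x y : prec x y -> strong_way_below x y.
Proof.
move=> /precP[V [/upper_topologyS/strong_scott_topologyP oV Vy Vx]].
have [W [oW Wy WV]] := oV _ Vy.
by apply: strong_way_below_of_open oW Wy _ => z /WV/Vx.
Qed.

Lemma prec_upper_topology U :
  (forall x, U x -> exists2 u, prec u x & up u `<=` U) -> upper_topology L U.
Proof.
move=> pU; rewrite /upper_topology openE => x /pU[u ux uU].
exact: (@interiorS (upper_space L)) uU _ ux.
Qed.

(** The set of elements prec x is directed with supremum x, so it meets U. *)
Lemma hypercontinuous_prec_basis U x : hypercontinuous L ->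
  strong_scott_topology L U -> U x ->
  exists u, [/\ U u, prec u x & up u `<=` U].
Proof.
move=> hL oU Ux; have [dx sx] := hL x.
have [u ux Uu] := strong_scott_topology_meets oU dx sx Ux.
exists u; split=> // y uy; move/strong_scott_topologyP: oU => /(_ _ Uu).
by move=> [V [[upV _] Vu VU]]; apply: VU; exact: upper_set_le uy.
Qed.

Lemma hypercontinuous_strongly_continuous :
  hypercontinuous L -> strongly_continuous L.
Proof.
move=> hL U x oU Ux.
have [u [Uu /precP[V [oV Vx Vu]] uU]] := hypercontinuous_prec_basis hL oU Ux.
exists u; split=> //; rewrite /interior nbhsE; exists V => //; split=> //.
exact: upper_topologyS.
Qed.

Lemma hypercontinuous_strong_way_below : hypercontinuous L ->
  forall x y, strong_way_below x y <-> prec x y.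
Proof.
move=> hL x y; split; last exact: prec_strong_way_below.
have [dy sy] := hL y.
by move=> /strong_way_below_le/(_ dy sy)[e ey xe]; exact: le_prec_trans ey.
Qed.

Lemma strongly_continuous_eq_topology : strongly_continuous L ->
  (forall x y, strong_way_below x y -> prec x y) ->
  upper_topology L = strong_scott_topology L.
Proof.
move=> cL wp; apply/seteqP; split=> [|U oU]; first exact: upper_topologyS.
apply: prec_upper_topology => x Ux.
have [u [Uu /strong_scott_interiorP[V [oV Vx Vu]] uU]] := cL U x oU Ux.
by exists u => //; apply: wp; exact: strong_way_below_of_open oV Vx Vu.
Qed.

(** When the topologies agree, strong continuity puts some u with [prec u x]
    inside every upper neighbourhood of x. The neighbourhood
    [int (up y) `&` int (up z)] yields directedness of the elements prec x;
    if z is an upper bound of them not above x, the neighbourhood [~` down z]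
    yields a contradiction. *)
Lemma strongly_continuous_hypercontinuous : strongly_continuous L ->
  upper_topology L = strong_scott_topology L -> hypercontinuous L.
Proof.
move=> cL eqT.
have cU U x : upper_topology L U -> U x -> exists2 u, U u & prec u x.
  rewrite eqT => oU Ux.
  have [u [Uu /strong_scott_interiorP[V [oV Vx Vu]] _]] := cL U x oU Ux.
  exists u => //; apply/precP; exists V; split=> //.
  by rewrite eqT; exact: strongly_scott_open_topology.
move=> x; split; split.
- have [||u _ ux] := cU setT x; [exact: (@openT (upper_space L))|by []|].
  by exists u.
- move=> y z yx zx.
  have [||u [yu zu] ux] := cU ((prec y : set L) `&` prec z) x.
  + by apply: (@openI (upper_space L)); exact: open_interior.
  + by [].
  by exists u; split=> //; exact: prec_le.
- by move=> y; exact: prec_le.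
- move=> z xz; apply: contrapT => nxz.
  have [u nuz ux] := cU _ _ (upper_topologyC_down z) nxz.
  by apply: nuz; exact: xz.
Qed.

End StrongScott.

Theorem theorem3p10 (d : Order.disp_t) (L : porderType d) (hL : dcpo L) :
  [<-> hypercontinuous L;
       strongly_continuous L /\
         (forall x y : L, strong_way_below x y <-> prec x y);
       strongly_continuous L /\ upper_topology L = strong_scott_topology L].
Proof.
tfae=> [hyp|[cL wp]|[]]; last exact: strongly_continuous_hypercontinuous.
- split; first exact: hypercontinuous_strongly_continuous.
  exact: hypercontinuous_strong_way_below.
- split=> //; apply: strongly_continuous_eq_topology => // x y.
  by move/wp.
Qed.
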